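(* Let $n$ be a positive integer and let $p$ be a prime number. Let $A\in\mathcal{M}_n(\mathbb{C}_p)$ and $v_0=(v_{01},\ldots,v_{0n})\in(\mathbb{C}_p)^n$. Let $\lambda$ be an eigenvalue of $A$. Let $r\ge 1$ be the rank of $\lambda\mathrm{I}_n-A$. Let $I\subset\{1,\ldots,n\}$ be of size $r$. Suppose that $\mathrm{Ind}_p((\lambda\mathrm{I}_n-A)_{I\cdot})\ne 0$. Let $$R=\frac{1}{\mathrm{Ind}_p((\lambda\mathrm{I}_n-A)_{I\cdot})}\max_{i\in I}\frac{|\lambda v_{0i}-A_{i\cdot}v_0|_p}{\|\lambda\mathrm{e}_i-A_{i\cdot}\|_p},$$ and suppose $R>0$. Then there exist infinitely many vectors $v\in(\mathbb{C}_p)^n$ with $\|v-v_0\|_p\le R$ such that $v$ is an eigenvector of $A$ corresponding to $\lambda$.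
   Context: $\mathbb{C}_p$ is the completion of the algebraic closure of $\mathbb{Q}_p$, with $p$-adic absolute value $|\cdot|_p$, and $\|(v_1,\ldots,v_n)\|_p=\max_i|v_i|_p$. $\mathrm{I}_n$ is the identity matrix and $\mathrm{e}_i$ the $i$-th canonical basis vector (as a row where needed). For a matrix $B$, $B_{I\cdot}$ is the submatrix of the rows indexed by $I$, $B_{\cdot J}$ the submatrix of the columns indexed by $J$, and $B_{i\cdot}$ the $i$-th row. The independence number of $B\in\mathcal{M}_{m\times n}(\mathbb{C}_p)$, where $1\le m\le n$, is $$\mathrm{Ind}_p(B)=\begin{cases}\dfrac{\max_{|J|=m}|\det B_{\cdot J}|_p}{\prod_{i=1}^m\|B_{i\cdot}\|_p} & \text{if no row of }B\text{ is identically }0;\\ 0 & \text{otherwise.}\end{cases}$$ *)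

(* Defs.v *)
From HB Require Import structures.
From mathcomp Require Import all_boot all_order all_algebra.
From mathcomp Require Import boolp classical_sets functions cardinality reals.

Set Implicit Arguments.
Unset Strict Implicit.
Unset Printing Implicit Defensive.

Import Order.TTheory GRing.Theory Num.Theory.
Local Open Scope ring_scope.

(* The field of p-adic complex numbers is not constructed: it is specified, up
   to isometric isomorphism, by the tower
     rat -> Qp -> algebraic closure of Qp -> Cp
   in which the first and last maps are completions. *)
Section AbsoluteValues.
Variable R : realType.

Record nonarch_absval (F : fieldType) (abs : F -> R) : Prop := NonarchAbsval {
  absval_ge0 : forall x, 0 <= abs x;
  absval_eq0 : forall x, abs x = 0 <-> x = 0;
  absvalM : forall x y, abs (x * y) = abs x * abs y;
  absvalD : forall x y, abs (x + y) <= Num.max (abs x) (abs y)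
}.

Definition abs_cauchy (F : fieldType) (abs : F -> R) (u : nat -> F) : Prop :=
  forall e : R, 0 < e -> exists N : nat, forall i j : nat,
    (N <= i)%N -> (N <= j)%N -> abs (u i - u j) < e.

Definition abs_converges (F : fieldType) (abs : F -> R) (u : nat -> F) (l : F) :
    Prop :=
  forall e : R, 0 < e -> exists N : nat, forall i : nat,
    (N <= i)%N -> abs (u i - l) < e.

Definition abs_complete (F : fieldType) (abs : F -> R) : Prop :=
  forall u : nat -> F, abs_cauchy abs u -> exists l : F, abs_converges abs u l.

Definition abs_extends (F K : fieldType) (absF : F -> R) (absK : K -> R)
    (iota : {rmorphism F -> K}) : Prop :=
  nonarch_absval absK /\ forall x, absK (iota x) = absF x.

Definition is_completion (F K : fieldType) (absF : F -> R) (absK : K -> R)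
    (iota : {rmorphism F -> K}) : Prop :=
  [/\ abs_extends absF absK iota,
      abs_complete absK
    & forall (y : K) (e : R), 0 < e -> exists x : F, absK (y - iota x) < e].

Definition is_algebraic_closure (F L : fieldType) (iota : {rmorphism F -> L}) :
    Prop :=
  GRing.closed_field_axiom L /\ forall y : L, algebraicOver iota y.

(* |x|_p = p ^ (- v_p(x)), where v_p(a / b) = v_p(a) - v_p(b). *)
Definition rat_padic_abs (p : nat) (x : rat) : R :=
  if x == 0 then 0 else
  (p%:R : R) ^ ((logn p `|denq x|%N)%:Z - (logn p `|numq x|%N)%:Z).

Definition is_Qp (p : nat) (Qp : fieldType) (absQp : Qp -> R) : Prop :=
  exists iota : {rmorphism rat -> Qp},
    is_completion (rat_padic_abs p) absQp iota.

Definition is_Cp (p : nat) (Cp : fieldType) (abs : Cp -> R) : Prop :=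
  exists (Qp : fieldType) (absQp : Qp -> R) (L : fieldType) (absL : L -> R)
         (i : {rmorphism Qp -> L}) (j : {rmorphism L -> Cp}),
    [/\ is_Qp p absQp,
        is_algebraic_closure i,
        abs_extends absQp absL i
      & is_completion absL abs j].

End AbsoluteValues.

Section Matrices.
Variables (R : realType) (K : fieldType) (abs : K -> R).

Definition supnorm (m n : nat) (v : 'M[K]_(m, n)) : R :=
  \big[Num.max/0]_(i < m) \big[Num.max/0]_(j < n) abs (v i j).

Definition rows_of (m n : nat) (I : {set 'I_m}) (B : 'M[K]_(m, n)) :
    'M[K]_(#|I|, n) := rowsub (fun k : 'I_#|I| => enum_val k) B.

(* The columns of B indexed by an m-element set J, in increasing order. *)
Definition cols_of (m n : nat) (J : {J : {set 'I_n} | #|J| == m})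
    (B : 'M[K]_(m, n)) : 'M[K]_m :=
  colsub (fun k : 'I_m => enum_val (cast_ord (esym (eqP (valP J))) k)) B.

Definition Ind (m n : nat) (B : 'M[K]_(m, n)) : R :=
  if [forall i : 'I_m, row i B != 0] then
    (\big[Num.max/0]_(J : {J : {set 'I_n} | #|J| == m})
       abs (\det (cols_of J B)))
    / \prod_(i < m) supnorm (row i B)
  else 0.

End Matrices.

(* MathComp's eigenvalue and eigenspace act on row vectors; here the
   eigenvectors are columns. *)
Definition is_eigenvector (K : fieldType) (n : nat) (A : 'M[K]_n) (lambda : K)
    (v : 'cV[K]_n) : Prop :=
  v != 0 /\ A *m v = lambda *: v.

Definition is_eigenvalue (K : fieldType) (n : nat) (A : 'M[K]_n) (lambda : K) :
    Prop :=
  exists v : 'cV[K]_n, is_eigenvector A lambda v.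

(* Main.v *)
(* Let [B] be the rows of [lambda - A] indexed by [I]; as [B] has full row rank
   [r], it has the same kernel as [lambda - A].  Cramer's rule on a maximal minor
   of [B] gives [w], supported on the columns of that minor, with
   [B w = B v0].  Its coordinates are quotients of determinants, which the
   ultrametric inequality bounds by products of row norms, so that
   [|w| <= R].  Adding to the eigenvector (or null vector) [v0 - w] the multiples
   [t ^ m k] of a fixed eigenvector [k], with [t = p] and [m] large, stays in the
   ball and gives infinitely many vectors, at most one of which is zero. *)
Require Import Defs.
From HB Require Import structures.
From mathcomp Require Import all_boot all_order all_algebra.
From mathcomp Require Import boolp classical_sets functions cardinality reals.

Set Implicit Arguments.
Unset Strict Implicit.
Unset Printing Implicit Defensive.

Import Order.TTheory GRing.Theory Num.Theory.
Local Open Scope classical_set_scope.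
Local Open Scope ring_scope.
Section NonarchimedeanAbs.
Variables (R : realType) (K : fieldType) (abs : K -> R).
Hypothesis habs : nonarch_absval abs.

Let abs_ge0 := absval_ge0 habs.
Let absM := absvalM habs.

Lemma absval0 : abs 0 = 0.
Proof. exact/(absval_eq0 habs). Qed.

Lemma absval_gt0 x : x != 0 -> 0 < abs x.
Proof.
move=> /eqP x0; rewrite lt_neqAle abs_ge0 andbT eq_sym.
by apply/eqP=> /(absval_eq0 habs).
Qed.

Lemma absval1 : abs 1 = 1.
Proof.
have /lt0r_neq0 h := absval_gt0 (oner_neq0 K).
by apply: (mulfI h); rewrite -absM !mulr1.
Qed.

Lemma absvalX x m : abs (x ^+ m) = abs x ^+ m.
Proof. by elim: m => [|m IH]; rewrite ?absval1 // !exprS absM IH. Qed.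

Lemma absvalN x : abs (- x) = abs x.
Proof.
(* Both sides are nonnegative, so it suffices to compare their squares. *)
have hN1 : abs (-1) = 1.
  apply/eqP; rewrite -(@eqrXn2 _ 2) // expr1n -absvalX sqrrN expr1n.
  by rewrite absval1.
by rewrite -mulN1r absM hN1 mul1r.
Qed.

Lemma absval_sign (m : nat) : abs ((-1) ^+ m) = 1.
Proof. by rewrite absvalX absvalN absval1 expr1n. Qed.

Lemma absvalV x : abs x^-1 = (abs x)^-1.
Proof.
have [->|x0] := eqVneq x 0; first by rewrite invr0 absval0 invr0.
apply: (mulfI (lt0r_neq0 (absval_gt0 x0))).
by rewrite -absM !divff ?absval1 ?lt0r_neq0 ?absval_gt0.
Qed.

Lemma absvalD_le x y c : abs x <= c -> abs y <= c -> abs (x + y) <= c.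
Proof.
by move=> xc yc; apply: le_trans (absvalD habs x y) _; rewrite ge_max xc.
Qed.

Lemma absval_sum_le (J : Type) (s : seq J) (P : pred J) (F : J -> K) c :
  0 <= c -> (forall j, P j -> abs (F j) <= c) ->
  abs (\sum_(j <- s | P j) F j) <= c.
Proof.
move=> c0 Fc; elim/big_rec: _ => [|j x Pj xc]; first by rewrite absval0.
exact: absvalD_le (Fc j Pj) xc.
Qed.

Lemma absval_prod (J : Type) (s : seq J) (P : pred J) (F : J -> K) :
  abs (\prod_(j <- s | P j) F j) = \prod_(j <- s | P j) abs (F j).
Proof. exact: (big_morph abs absM absval1). Qed.

(** Ultrametric Hadamard inequality: each term of the Leibniz expansion is, up to sign, a product
    with one entry from each row. *)
Lemma absval_det_le m (C : 'M[K]_m) (c : 'I_m -> R) :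
  (forall i j, abs (C i j) <= c i) -> abs (\det C) <= \prod_i c i.
Proof.
move=> Cc; apply: absval_sum_le => [|s _].
  by apply: prodr_ge0 => i _; apply: le_trans (Cc i i).
rewrite absM absval_sign mul1r absval_prod.
by apply: ler_prod => i _; rewrite abs_ge0 Cc.
Qed.

(** By Cramer's rule each coordinate is a sum of terms [b i 0] times a cofactor along row [i], over
    [\det C]. The cofactor omits row [i], so it is at most the product of the other [c k]; the
    missing factor [c i] comes from [abs (b i 0) <= e * c i]. *)
Lemma absval_solve_le m (C : 'M[K]_m) (b : 'cV[K]_m) (c : 'I_m -> R) (e : R) :
    \det C != 0 -> 0 <= e -> (forall i, 0 < c i) ->
    (forall i j, abs (C i j) <= c i) -> (forall i, abs (b i 0) / c i <= e) ->
  forall j, abs ((invmx C *m b) j 0) <= (\prod_i c i) / abs (\det C) * e.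
Proof.
move=> detC e0 c0 Cc be j.
have P0 : 0 <= \prod_i c i by apply: prodr_ge0 => i _; exact: ltW.
have D0 := absval_gt0 detC.
rewrite mxE; apply: absval_sum_le => [|i _].
  by rewrite !mulr_ge0 // invr_ge0 ltW.
rewrite /invmx unitmxE unitfE detC !mxE !absM absvalV absval_sign mul1r.
rewrite -mulrA [leRHS]mulrAC [leRHS]mulrC ler_wpM2l ?invr_ge0 ?abs_ge0 //.
(* Splitting off [c i] leaves a product over [lift i k], exactly the rows that survive in the
   minor. *)
rewrite (bigD1_ord i) //= mulrAC mulrC ler_pM ?abs_ge0 //.
  by rewrite mulrC -ler_pdivrMr.
by apply: absval_det_le => k l; rewrite !mxE.
Qed.

Lemma supnorm_ge0 m k (v : 'M[K]_(m, k)) : 0 <= supnorm abs v.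
Proof. exact: bigmax_ge_id. Qed.

Lemma absval_le_supnorm m k (v : 'M[K]_(m, k)) i j :
  abs (v i j) <= supnorm abs v.
Proof.
apply: (bigmax_sup i) => //.
exact: (le_bigmax _ (fun j => abs (v i j))).
Qed.

Lemma supnorm_le m k (v : 'M[K]_(m, k)) c :
  0 <= c -> (forall i j, abs (v i j) <= c) -> supnorm abs v <= c.
Proof. by move=> c0 vc; apply: bigmax_le => // i _; apply: bigmax_le. Qed.

Lemma supnorm_gt0 m k (v : 'M[K]_(m, k)) : v != 0 -> 0 < supnorm abs v.
Proof.
move=> v0; rewrite lt_neqAle supnorm_ge0 andbT; apply: contra v0 => /eqP s0.
apply/eqP/matrixP=> i j; rewrite mxE; apply/(absval_eq0 habs)/eqP.
by rewrite eq_le abs_ge0 andbT s0 absval_le_supnorm.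
Qed.

Lemma ker_approx m n (B : 'M[K]_(m, n)) (v0 : 'cV[K]_n) (e : R) :
    Ind abs B != 0 -> 0 <= e ->
    (forall i, abs ((B *m v0) i 0) / supnorm abs (row i B) <= e) ->
  row_free B /\
  exists v : 'cV[K]_n, B *m v = 0 /\ supnorm abs (v - v0) <= 1 / Ind abs B * e.
Proof.
rewrite /Ind; case: ifP => [/forallP rowB|_]; last by rewrite eqxx.
set F := fun J => abs (\det (cols_of J B)) => Ind0 e0 Be.
have [J maxJ]: exists J, \big[Num.max/0]_J F J = F J.
  have [J _|noJ] := pickP (fun J : {J : {set 'I_n} | #|J| == m} => true).
    have [//| |J' _ ->] := @eq_bigmax _ _ _ 0 J predT F; last by exists J'.
    by move=> J' _; exact: abs_ge0.
  (* If there is no [m]-element set of columns, the maximum takes its default value 0, which forces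
     the independence number to vanish. *)
  by move: Ind0; rewrite big_pred0 ?mul0r ?eqxx.
move: Ind0; rewrite {}maxJ /F {F} => Ind0.
set C := cols_of J B in Ind0 *.
have detC : \det C != 0 by apply: contraNneq Ind0 => ->; rewrite absval0 mul0r.
have unitC : C \in unitmx by rewrite unitmxE unitfE.
have [f Cf] : exists f : 'I_m -> 'I_n, C = colsub f B by eexists.
(* On the right of [B], [S] selects the columns of the minor; applied to a vector, it places the
   coordinates in those positions and zeros elsewhere. *)
pose S : 'M[K]_(n, m) := colsub f 1%:M.
have BS : B *m S = C by rewrite mulmx_colsub mulmx1 Cf.
split.
  rewrite /row_free eqn_leq rank_leq_row /=.
  by have := mxrankM_maxl B S; rewrite BS mxrank_unit.
pose y := invmx C *m (B *m v0).
exists (v0 - S *m y); split.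
  by rewrite mulmxBr mulmxA BS mulKVmx ?subrr.
have bound : 0 <= (\prod_i supnorm abs (row i B)) / abs (\det C) * e.
  by rewrite !mulr_ge0 ?invr_ge0 // prodr_ge0 // => i _; exact: supnorm_ge0.
rewrite div1r invf_div; apply: supnorm_le => // k l.
rewrite addrAC subrr sub0r mxE absvalN mxE ord1.
apply: absval_sum_le => // j _; rewrite absM.
(* The entries of [S] are 0 or 1. *)
apply: (@le_trans _ _ (abs (y j 0))).
  by rewrite ler_piMl // !mxE; case: eqP; rewrite ?absval1 ?absval0.
apply: absval_solve_le => // [i|i j'].
  exact: supnorm_gt0.
have -> : C i j' = row i B 0 (f j') by rewrite Cf !mxE.
exact: absval_le_supnorm.
Qed.

Lemma infinite_near_eigenvectors n (A : 'M[K]_n) (lambda t : K)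
    (v0 v k : 'cV[K]_n) (rho : R) :
    t != 0 -> abs t <= 2^-1 -> is_eigenvector A lambda k ->
    A *m v = lambda *: v -> 0 < rho -> supnorm abs (v - v0) <= rho ->
  infinite_set [set x : 'cV[K]_n |
    supnorm abs (x - v0) <= rho /\ is_eigenvector A lambda x].
Proof.
move=> t0 t_small [k0 Ak] Av rho0 v_near.
(* This choice gives [supnorm abs k / rho < 2 ^+ N], so [t ^+ N *: k] has norm at most [rho]. *)
pose N := Num.bound (supnorm abs k / rho).
pose f (m : nat) : 'cV[K]_n := v + t ^+ (N + m) *: k.
have expt_inj : injective (fun m => t ^+ (N + m)).
  (* Since [0 < abs t < 1], distinct powers of [t] already differ in absolute value. *)
  move=> a b /(congr1 abs); rewrite !absvalX => /ieexprIn /addnI-> //.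
    exact: absval_gt0.
  by rewrite lt_eqF // (le_lt_trans t_small) ?invf_lt1 ?ltr1n.
have f_inj : injective f.
  move=> a b /addrI eqf; apply: expt_inj; apply/eqP; rewrite -subr_eq0.
  by move/eqP: eqf; rewrite -subr_eq0 -scalerBl scaler_eq0 (negPf k0) orbF.
have f_near m : supnorm abs (f m - v0) <= rho.
  apply: supnorm_le => [|i j]; first exact: ltW.
  rewrite /f addrAC !mxE; apply: absvalD_le.
    apply: le_trans v_near; have := absval_le_supnorm (v - v0) i j.
    by rewrite !mxE.
  rewrite absM absvalX.
  have tN : abs t ^+ (N + m) <= 2^-1 ^+ N.
    apply: (@le_trans _ _ (2^-1 ^+ (N + m))); first by apply: lerXn2r; rewrite ?nnegrE ?invr_ge0.
    by apply: ler_wiXn2l; rewrite ?invr_ge0 ?invf_le1 ?ler1n // leq_addr.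
  apply: (@le_trans _ _ (2^-1 ^+ N * supnorm abs k)).
    by apply: ler_pM; rewrite ?exprn_ge0 ?absval_le_supnorm.
  rewrite exprVn mulrC ler_pdivrMr ?exprn_gt0 // mulrC -ler_pdivrMr //.
  exact/ltW/upper_nthrootP.
have f_eigen m : A *m f m = lambda *: f m.
  by rewrite mulmxDr Av -scalemxAr Ak scalerDr !scalerA mulrC.
(* Every [f m] is an eigenvector or zero. Were the target set finite, so would be its union with
   [{0}], and the preimage of that union under the injective [f] is all of [nat]. *)
move=> fin; apply: infinite_nat.
move: (conj fin (finite_set1 (0 : 'cV[K]_n))); rewrite -finite_setU => finU.
apply: sub_finite_set (finite_preimage (f := f) _ finU) => [m _ /=|a b _ _].
  have [f0|f0] := eqVneq (f m) 0; [by right | by left].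
exact: f_inj.
Qed.

End NonarchimedeanAbs.

Lemma rat_padic_abs_prime (R : realType) p :
  prime p -> rat_padic_abs R p p%:Q = p%:R^-1.
Proof.
move=> pr_p; have p0 := prime_gt0 pr_p.
rewrite /rat_padic_abs intr_eq0 eqz_nat gtn_eqF // numq_int denq_int.
by rewrite /= logn1 lognE pr_p p0 dvdnn divnn p0 logn1.
Qed.

Lemma Cp_nonarch (R : realType) p (Cp : fieldType) (abs : Cp -> R) :
  is_Cp p abs -> nonarch_absval abs.
Proof. by case=> [? [? [? [? [? [? [_ _ _ [[]]]]]]]]]. Qed.

(** The image of [p] through the tower works: its absolute value is [1 / p], and [p >= 2]. *)
Lemma Cp_small (R : realType) p (Cp : fieldType) (abs : Cp -> R) :
  prime p -> is_Cp p abs -> exists t, t != 0 /\ abs t <= 2^-1.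
Proof.
move=> pr_p [Qp [absQp [L [absL [i [j [[k [[_ hk] _ _]] _ [_ hi] [[_ hj] _ _]]]]]]]].
have p0 := prime_gt0 pr_p.
exists (j (i (k p%:Q))); split.
  by rewrite !fmorph_eq0 intr_eq0 eqz_nat gtn_eqF.
rewrite hj hi hk rat_padic_abs_prime // lef_pV2 ?posrE ?ltr0n ?ler_nat //.
exact: prime_gt1.
Qed.

Theorem theorem4p1 (R : realType) (n p : nat) (hn : (0 < n)%N) (hp : prime p)
    (Cp : fieldType) (abs : Cp -> R) (hCp : is_Cp p abs)
    (A : 'M[Cp]_n) (v0 : 'cV[Cp]_n)
    (lambda : Cp) (hlambda : is_eigenvalue A lambda)
    (r : nat) (hr : r = \rank (lambda%:M - A)%R) (hr1 : (1 <= r)%N)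
    (I : {set 'I_n}) (hI : #|I| = r)
    (hInd : Ind abs (rows_of I (lambda%:M - A)) <> 0) :
  let rho : R :=
    1 / Ind abs (rows_of I (lambda%:M - A)) *
    \big[Num.max/0]_(i in I)
      (abs (lambda * v0 i 0 - (row i A *m v0) 0 0) /
       supnorm abs (lambda *: delta_mx 0 i - row i A)) in
  0 < rho ->
  infinite_set [set v : 'cV[Cp]_n |
    supnorm abs (v - v0) <= rho /\ is_eigenvector A lambda v].
Proof.
move=> rho rho0.
have habs := Cp_nonarch hCp.
have [t [t0 t_small]] := Cp_small hp hCp.
have [k k_eigen] := hlambda.
set M := lambda%:M - A in hInd hr rho rho0 *.
set B := rows_of I M in hInd rho rho0 *.
have rowM i : row i M = lambda *: delta_mx 0 i - row i A.
  by apply/rowP=> j; rewrite !mxE eqxx /= eq_sym mulr_natr.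
have [||i|freeB [v [Bv v_near]]] := ker_approx habs (B := B) (v0 := v0)
    (e := \big[Num.max/0]_(i in I)
      (abs (lambda * v0 i 0 - (row i A *m v0) 0 0) /
       supnorm abs (lambda *: delta_mx 0 i - row i A))).
- exact/eqP.
- exact: bigmax_ge_id.
- apply: (bigmax_sup (enum_val i)); first exact: enum_valP.
  have -> : row i B = row (enum_val i) M.
    by apply/rowP=> j; rewrite !mxE.
  have -> : (B *m v0) i 0 = (row (enum_val i) M *m v0) 0 0.
    by rewrite !mxE; apply: eq_bigr => j _; rewrite !mxE.
  rewrite rowM; set a := row _ A.
  have -> // : ((lambda *: delta_mx 0 (enum_val i) - a) *m v0) 0 0 =
      lambda * v0 (enum_val i) 0 - (a *m v0) 0 0.
  by rewrite mulmxBl -scalemxAl -rowE !mxE.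
have Mv : M *m v = 0.
  have BM : (B <= M)%MS by exact: rowsub_sub.
  (* The row space of [B] lies in that of [M] and both have dimension [r], so they coincide. Hence
     [M = D *m B] for some [D], and [B *m v = 0] gives [M *m v = 0]. *)
  have : (M <= B)%MS.
    by rewrite -(mxrank_leqif_sup BM) -hr -hI; move: freeB.
  by case/submxP => D ->; rewrite -mulmxA Bv mulmx0.
apply: (infinite_near_eigenvectors habs t0 t_small k_eigen _ rho0 v_near).
by apply/eqP; rewrite eq_sym -subr_eq0 -mul_scalar_mx -mulmxBl Mv.
Qed.
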